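(* Let $X$ be a separable complex Hilbert space and let $x_j\in X$, $j=1,2,\dots$. The linear moment problem $$c_j=(x_j,g),\qquad j=1,2,\dots,$$ has a solution $g\in X$ for every complex sequence $\{c_j\}_{j\ge1}$ with $\sum_{j=1}^\infty|c_j|^2<\infty$ if and only if the sequence $\{x_j\}_{j\ge1}$ is strongly minimal.
   Context: Definition: for a sequence $\{x_j\}_{j\ge1}$ in $X$ let $G_n=\{(x_i,x_j)\}_{i,j=1}^n$ be the Gram matrix of its first $n$ elements and let $\gamma_n^{\min}$ be the minimal eigenvalue of $G_n$. The sequence $\gamma_n^{\min}$ is non-increasing and nonnegative, so it has a limit. The sequence $\{x_j\}$ is called strongly minimal if $\gamma^{\min}=\lim_{n\to\infty}\gamma_n^{\min}>0$. *)

(* Defs.v *)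
From HB Require Import structures.
From mathcomp Require Import all_boot all_order all_algebra.
From mathcomp Require Import all_classical all_reals all_analysis.
From mathcomp Require Import complex.

Set Implicit Arguments.
Unset Strict Implicit.
Unset Printing Implicit Defensive.

Import Order.TTheory GRing.Theory Num.Theory Num.Def.
Import numFieldNormedType.Exports.

Local Open Scope classical_set_scope.
Local Open Scope ring_scope.
Local Open Scope complex_scope.

Definition separable_space (T : topologicalType) : Prop :=
  exists2 D : set T, countable D & dense D.

(* Sequences are indexed from 0: [x j] stands for $x_{j+1}$, so that [gram ip x n]
   is the Gram matrix of the first [n] elements. The inner product [ip] is linear
   in its first argument and conjugate-linear in its second. *)
Definition gram (R : realType) (X : lmodType R[i]) (ip : {dot X for conjC})
    (x : nat -> X) (n : nat) : 'M[R[i]]_n :=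
  \matrix_(i < n, j < n) ip (x i) (x j).

(* On [R[i]], [a <= b] says that [b - a] is a nonnegative real, so the second
   conjunct forces every eigenvalue of [A] to be real. *)
Definition is_min_eigenvalue (R : realType) (n : nat) (A : 'M[R[i]]_n) (g : R) :
    Prop :=
  eigenvalue A g%:C /\ forall a : R[i], eigenvalue A a -> g%:C <= a.

(* The default value 0 is only used when no minimal eigenvalue exists; for a Gram
   matrix this happens only in size 0, see [gram_min_eigenvalueP]. *)
Definition min_eigenvalue (R : realType) (n : nat) (A : 'M[R[i]]_n) : R :=
  xget 0 [set g : R | is_min_eigenvalue A g].

Definition strongly_minimal (R : realType) (X : lmodType R[i])
    (ip : {dot X for conjC}) (x : nat -> X) : Prop :=
  0 < limn (fun n => min_eigenvalue (gram ip x n)).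

Definition square_summable (R : realType) (c : nat -> R[i]) : Prop :=
  (\sum_(0 <= j <oo) (Normc.normc (c j) ^+ 2)%:E < +oo)%E.

Lemma gram_eigenvalue_ge0 (R : realType) (X : lmodType R[i])
    (ip : {dot X for conjC}) (x : nat -> X) (n : nat) (a : R[i]) :
  eigenvalue (gram ip x n) a -> 0 <= a.
Proof.
move=> /eigenvalueP[v vG v0].
pose s := \sum_j `|v 0 j| ^+ 2.
have s_gt0 : 0 < s.
  rewrite lt_def sumr_ge0 ?andbT; last by move=> j _; exact: exprn_ge0.
  apply: contra_neq v0 => /eqP; rewrite psumr_eq0; last first.
    by move=> j _; exact: exprn_ge0.
  move=> /allP vj; apply/rowP => j; rewrite mxE; apply/eqP.
  by have := vj j (mem_index_enum j); rewrite expf_eq0 normr_eq0.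
pose u := \sum_i v 0 i *: x i.
have uu : ip u u = a * s.
  rewrite /s mulr_sumr [in X in ip _ X]/u linear_sumr; apply: eq_bigr => j _.
  rewrite linearZr_LR /= /u linear_sumlz.
  have := congr1 (fun w : 'rV_n => w 0 j) vG; rewrite !mxE => vGj.
  under eq_bigr => i _ do rewrite linearZl_LR /=.
  have -> : \sum_i v 0 i * ip (x i) (x j) = a * v 0 j.
    by rewrite -vGj; apply: eq_bigr => i _; rewrite mxE.
  by rewrite mulrC -mulrA -normCK.
have uu_ge0 : 0 <= ip u u.
  have [->|u_neq0] := eqVneq u 0; first by rewrite linear0l.
  exact/ltW/neq0_dnorm_gt0.
by rewrite uu pmulr_lge0 in uu_ge0.
Qed.

Lemma gram_min_eigenvalueP (R : realType) (X : lmodType R[i])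
    (ip : {dot X for conjC}) (x : nat -> X) (n : nat) :
  (0 < n)%N -> is_min_eigenvalue (gram ip x n) (min_eigenvalue (gram ip x n)).
Proof.
move=> n_gt0; set A := gram ip x n.
suff [g gP] : exists g : R, is_min_eigenvalue A g by exact: (xgetI 0 gP).
have [rs Ars] := closed_field_poly_normal (char_poly A).
have eigA a : eigenvalue A a = (a \in rs).
  rewrite eigenvalue_root_char Ars (monicP (char_poly_monic A)) scale1r.
  exact: root_prod_XsubC.
have real_rs a : a \in rs -> (complex.Re a)%:C = a.
  by rewrite -eigA => /gram_eigenvalue_ge0 /ger0_real /RRe_real.
have [a0 a0A] := eigenvalue_closed A n_gt0.
have i0lt : (index a0 rs < size rs)%N by rewrite index_mem -eigA.
pose F (i : 'I_(size rs)) : R := complex.Re rs`_i.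
have [i _ imin] := @arg_minP _ _ _ (Ordinal i0lt) xpredT F isT.
have rsi : rs`_i \in rs by rewrite mem_nth.
have gE := real_rs _ rsi; exists (complex.Re rs`_i); split.
  by rewrite gE eigA rsi.
move=> a; rewrite eigA => ars; rewrite -(real_rs _ ars) lecR.
have alt : (index a rs < size rs)%N by rewrite index_mem.
have := imin (Ordinal alt) isT; rewrite /F /=.
by rewrite (nth_index 0 ars).
Qed.

(* Main.v *)
Require Import Defs.
From HB Require Import structures.
From mathcomp Require Import all_boot all_order all_algebra.
From mathcomp Require Import all_classical all_reals all_analysis.
From mathcomp Require Import complex ring.

Set Implicit Arguments.
Unset Strict Implicit.
Unset Printing Implicit Defensive.

Import Order.TTheory GRing.Theory Num.Theory Num.Def.
Import numFieldNormedType.Exports.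

Local Open Scope ring_scope.
Local Open Scope complex_scope.
Local Open Scope sesquilinear_scope.

(** Write [S n v] for [\sum_(i < n) v i *: x i]. Since [|S n v| ^+ 2] is the
    quadratic form of the Gram matrix, the spectral theorem makes the minimal
    eigenvalue the best constant [d] in [d * \sum_(i < n) |v i| ^+ 2 <=
    |S n v| ^+ 2]. Strong minimality is therefore equivalent to a lower Riesz bound:
    one constant [d > 0] that works for all [n] and [v] ([strongly_minimalP]).

    If there is a lower Riesz bound, the Gram matrices are invertible and the first
    [n] moment equations have a solution [g n] in the span of [x 0], ..,
    [x (n - 1)]. The bound gives [|g n| ^+ 2 <= d^-1 * \sum_i |c i| ^+ 2], and the
    increments of [g] are orthogonal, so [g] converges, by completeness; its limit
    solves all the equations ([lower_riesz_moment_problem]).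

    Conversely, assume that every square summable sequence is a moment sequence.
    Solving for the unit sequences gives a biorthogonal family [y], and
    [|v i| <= |S n v| * |y i|]. If there were no lower Riesz bound, there would be
    unit vectors [v] with [S n v] as small as wanted, and by the last inequality
    their mass escapes to large indices. A gliding hump argument, an explicit
    substitute for the uniform boundedness principle in the space of square summable
    sequences, assembles from such vectors a square summable sequence that is the
    moment sequence of no vector ([moment_problem_lower_riesz]). *)

(** * Minimal eigenvalue of a hermitian matrix *)

(** In an orthonormal eigenbasis the quadratic form is a sum of the eigenvalues
    weighted by the squared coordinates, and unitary changes of basis preserve
    the sum of squared moduli. *)
Lemma min_eigenvalue_rayleigh (R : realType) (n : nat) (A : 'M[R[i]]_n) (g : R)
    (v : 'rV_n) :
  A \is hermsymmx -> is_min_eigenvalue A g ->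
  g%:C * (\sum_i `|v 0 i| ^+ 2) <= (v *m A *m v ^t*) 0 0.
Proof.
move=> Aherm [_ gmin].
have /orthomx_spectralP Aeq := hermitian_normalmx Aherm.
set P := spectralmx A in Aeq; set d := spectral_diag A in Aeq.
have Punit : P \in unitmx := spectral_unit A.
have Pinv : invmx P = P ^t* := invmx_unitary (spectral_unitarymx A).
pose w := v *m P ^t*.
have wT : w ^t* = P *m v ^t* by rewrite /w trmx_mul map_mxM /= trmxCK.
have sumE : \sum_i `|v 0 i| ^+ 2 = \sum_i `|w 0 i| ^+ 2.
  have sqE (u : 'rV[R[i]]_n) : \sum_i `|u 0 i| ^+ 2 = (u *m u ^t*) 0 0.
    by rewrite mxE; apply: eq_bigr => i _; rewrite !mxE normCK.
  by rewrite !sqE wT mulmxA -(mulmxA v) -Pinv mulVmx // mulmx1.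
have -> : (v *m A *m v ^t*) 0 0 = \sum_i d 0 i * `|w 0 i| ^+ 2.
  rewrite Aeq Pinv !mulmxA -(mulmxA _ P) -wT -/w mxE.
  apply: eq_bigr => i _.
  by rewrite mul_mx_diag !mxE normCK mulrAC mulrC mulrA.
rewrite sumE mulr_sumr; apply: ler_sum => i _.
apply: ler_wpM2r; first exact: exprn_ge0.
apply: gmin; apply/eigenvalueP; exists (row i P).
  rewrite {1}Aeq !mulmxA -row_mul mulmxV // row1 -rowE row_diag_mx.
  by rewrite -scalemxAl -rowE.
apply: contraTneq Punit => Pi0; rewrite unitmxE unitfE negbK.
rewrite (expand_det_row _ i) big1 // => j _.
by move/rowP: Pi0 => /(_ j); rewrite !mxE => ->; rewrite mul0r.
Qed.

(** * Inner products and linear combinations *)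

Lemma dot_conj (R : realType) (X : lmodType R[i]) (ip : {dot X for conjC})
  (u v : X) : ip u v = conjC (ip v u).
Proof. by rewrite hermC /= expr0 mul1r. Qed.

(** Positivity of the form at [ip v v *: u - ip u v *: v], a multiple of the
    component of [u] orthogonal to [v]. *)
Lemma dot_cauchy_schwarz (R : realType) (X : lmodType R[i])
    (ip : {dot X for conjC}) (u v : X) :
  `|ip u v| ^+ 2 <= ip u u * ip v v.
Proof.
have [->|v0] := eqVneq v 0.
  by rewrite linear0r normr0 expr0n mulr_ge0 ?dnorm_ge0.
set a := ip u v; set b := ip v v.
have b_gt0 : 0 < b by rewrite dnorm_gt0.
have bC : conjC b = b by apply: geC0_conj; exact: ltW.
have aE : ip (b *: u) (a *: v) = b * `|a| ^+ 2.
  by rewrite linearZl_LR linearZr_LR /= -/a normCK (mulrC a).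
have := dnorm_ge0 ip (b *: u - a *: v).
rewrite dnormB !dnormZ aE -/b rmorphM /= bC rmorphXn /= conj_normC.
rewrite (gtr0_norm b_gt0).
set t := `|a| ^+ 2.
have -> : b ^+ 2 * ip u u + t * b - (b * t + b * t) = b * (ip u u * b - t).
  by rewrite mulrBr expr2 -mulrA (mulrC b (ip u u)) (mulrC t) opprD addrA addrK.
by rewrite pmulr_rge0 // subr_ge0.
Qed.

Lemma dot_le_norm (R : realType) (X : normedModType R[i])
    (ip : {dot X for conjC}) (ip_norm : forall u : X, ip u u = `|u| ^+ 2)
    (u v : X) : `|ip u v| <= `|u| * `|v|.
Proof.
rewrite -(@ler_pXn2r _ 2) ?nnegrE ?mulr_ge0 // exprMn -!ip_norm.
exact: dot_cauchy_schwarz.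
Qed.

Definition lin_comb (R : realType) (X : lmodType R[i]) (x : nat -> X) (n : nat)
  (v : nat -> R[i]) : X := \sum_(i < n) v i *: x i.

(** Coefficients are indexed by all of [nat], so that the same coefficients can
    be used with a Gram matrix of any size; a row vector is extended by zero. *)
Definition row_seq (R : realType) (n : nat) (v : 'rV[R[i]]_n) : nat -> R[i] :=
  fun k => oapp (v 0) 0 (insub k).

Lemma row_seqE (R : realType) (n : nat) (v : 'rV[R[i]]_n) (k : 'I_n) :
  row_seq v k = v 0 k.
Proof. by rewrite /row_seq valK. Qed.

Lemma dot_lin_combl (R : realType) (X : lmodType R[i]) (ip : {dot X for conjC})
    (x : nat -> X) (n : nat) (v : nat -> R[i]) (g : X) :
  ip (lin_comb x n v) g = \sum_(i < n) v i * ip (x i) g.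
Proof.
by rewrite linear_sumlz; apply: eq_bigr => i _; rewrite linearZl_LR.
Qed.

Lemma dot_lin_comb (R : realType) (X : lmodType R[i]) (ip : {dot X for conjC})
    (x : nat -> X) (n : nat) (v w : nat -> R[i]) :
  ip (lin_comb x n v) (lin_comb x n w) =
  ((\row_(i < n) v i) *m gram ip x n *m (\row_(i < n) w i) ^t*) 0 0.
Proof.
rewrite /lin_comb linear_sumr mxE; apply: eq_bigr => j _.
rewrite linearZr_LR /= linear_sumlz !mxE mulrC; congr (_ * _).
by apply: eq_bigr => i _; rewrite linearZl_LR /= !mxE.
Qed.

(** * Strong minimality as a lower Riesz bound *)

Lemma gram_hermitian (R : realType) (X : lmodType R[i]) (ip : {dot X for conjC})
    (x : nat -> X) (n : nat) : gram ip x n \is hermsymmx.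
Proof.
apply/is_hermitianmxP; rewrite expr0 scale1r; apply/matrixP => i j.
by rewrite !mxE dot_conj.
Qed.

Lemma lower_bound_min_eigenvalue (R : realType) (X : lmodType R[i])
    (ip : {dot X for conjC}) (x : nat -> X) (n : nat) (v : nat -> R[i]) :
  (min_eigenvalue (gram ip x n))%:C * \sum_(i < n) `|v i| ^+ 2 <=
  ip (lin_comb x n v) (lin_comb x n v).
Proof.
case: n => [|n]; first by rewrite big_ord0 mulr0 dnorm_ge0.
have := min_eigenvalue_rayleigh (\row_(i < n.+1) v i) (gram_hermitian ip x n.+1)
  (gram_min_eigenvalueP ip x (ltn0Sn n)).
by rewrite dot_lin_comb; under eq_bigr => i _ do rewrite mxE.
Qed.

(** The witness is an eigenvector. Because it vanishes beyond [n], it is a test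
    vector for the larger Gram matrices too. *)
Lemma min_eigenvalue_attained (R : realType) (X : lmodType R[i])
    (ip : {dot X for conjC}) (x : nat -> X) (n : nat) : (0 < n)%N ->
  exists v : nat -> R[i],
  [/\ forall k, (n <= k)%N -> v k = 0, 0 < \sum_(i < n) `|v i| ^+ 2
    & ip (lin_comb x n v) (lin_comb x n v) =
      (min_eigenvalue (gram ip x n))%:C * \sum_(i < n) `|v i| ^+ 2].
Proof.
move=> n_gt0; have [/eigenvalueP[w wG w0] _] := gram_min_eigenvalueP ip x n_gt0.
exists (row_seq w); split.
- by move=> k nk; rewrite /row_seq insubF // ltnNge nk.
- rewrite lt_def sumr_ge0 ?andbT; last by move=> j _; exact: exprn_ge0.
  apply: contra_neq w0 => /eqP; rewrite psumr_eq0; last first.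
    by move=> j _; exact: exprn_ge0.
  move=> /allP wj; apply/rowP => j; rewrite mxE; apply/eqP.
  by have := wj j (mem_index_enum j); rewrite expf_eq0 normr_eq0 row_seqE.
- rewrite dot_lin_comb.
  have -> : \row_(i < n) row_seq w i = w by apply/rowP => i; rewrite mxE row_seqE.
  rewrite wG -scalemxAl mxE; congr (_ * _); rewrite mxE.
  by apply: eq_bigr => i _; rewrite !mxE normCK row_seqE.
Qed.

Lemma min_eigenvalue_ge (R : realType) (X : lmodType R[i])
    (ip : {dot X for conjC}) (x : nat -> X) (n : nat) (d : R) :
  (0 < n)%N ->
  (forall v : nat -> R[i], d%:C * \sum_(i < n) `|v i| ^+ 2 <=
     ip (lin_comb x n v) (lin_comb x n v)) ->
  d <= min_eigenvalue (gram ip x n).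
Proof.
move=> n_gt0 dP; have [v [_ s_gt0 vE]] := min_eigenvalue_attained ip x n_gt0.
by have := dP v; rewrite vE ler_pM2r // lecR.
Qed.

(** Appending a zero coordinate to a minimal eigenvector keeps its Rayleigh
    quotient. The sequence starts in size 1, because [min_eigenvalue] is only a
    default value in size 0. *)
Lemma min_eigenvalue_nonincreasing (R : realType) (X : lmodType R[i])
    (ip : {dot X for conjC}) (x : nat -> X) :
  nonincreasing_seq (fun n => min_eigenvalue (gram ip x n.+1)).
Proof.
apply/nonincreasing_seqP => n.
have [v [v0 s_gt0 vE]] := min_eigenvalue_attained ip x (ltn0Sn n).
have := lower_bound_min_eigenvalue ip x n.+2 v.
rewrite /lin_comb !(big_ord_recr n.+1) /= v0 // scale0r normr0 expr0n !addr0.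
by rewrite vE ler_pM2r // lecR.
Qed.

(** The lower half of the definition of a Riesz sequence: the form in which
    strong minimality is used, free of any reference to eigenvalues. *)
Definition lower_riesz (R : realType) (X : lmodType R[i])
    (ip : {dot X for conjC}) (x : nat -> X) (d : R) : Prop :=
  forall n (v : nat -> R[i]), d%:C * \sum_(i < n) `|v i| ^+ 2 <=
    ip (lin_comb x n v) (lin_comb x n v).

(** The constant is the limit of the minimal eigenvalues, which lies below each
    of them; conversely a lower bound passes to the limit. *)
Lemma strongly_minimalP (R : realType) (X : lmodType R[i])
    (ip : {dot X for conjC}) (x : nat -> X) :
  strongly_minimal ip x <-> exists2 d : R, 0 < d & lower_riesz ip x d.
Proof.
pose u n := min_eigenvalue (gram ip x n.+1).
have u_noninc : nonincreasing_seq u := min_eigenvalue_nonincreasing ip x.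
have u_cvg : cvgn u.
  apply: nonincreasing_is_cvgn => //; exists 0 => _ [n _ <-].
  apply: min_eigenvalue_ge => // v.
  by rewrite mul0r dnorm_ge0.
have limE : limn (fun n => min_eigenvalue (gram ip x n)) = limn u.
  apply: cvg_lim => //.
  by rewrite -(cvg_shiftS (fun n => min_eigenvalue (gram ip x n))).
rewrite /strongly_minimal limE; split=> [lim_gt0 | [d d_gt0 dP]].
- exists (limn u) => // n v.
  case: n => [|n]; first by rewrite big_ord0 mulr0 dnorm_ge0.
  apply: le_trans (lower_bound_min_eigenvalue ip x n.+1 v).
  apply: ler_wpM2r; first by apply: sumr_ge0 => i _; exact: exprn_ge0.
  by rewrite lecR; exact: nonincreasing_cvgn_ge.
- apply: lt_le_trans d_gt0 _; apply: limr_ge => //.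
  by apply: nearW => n; apply: min_eigenvalue_ge => // v; exact: dP.
Qed.

(** * A lower Riesz bound makes the moment problem solvable *)

Lemma square_summableP (R : realType) (c : nat -> R[i]) :
  square_summable c <->
  exists M : R, forall n, \sum_(i < n) `|c i| ^+ 2 <= M%:C.
Proof.
have sumE n : \sum_(i < n) `|c i| ^+ 2 =
    (\sum_(0 <= i < n) Normc.normc (c i) ^+ 2)%:C.
  rewrite big_mkord rmorph_sum /=; apply: eq_bigr => i _.
  by rewrite rmorphXn.
have c_ge0 i : (0 <= (Normc.normc (c i) ^+ 2)%:E)%E.
  by rewrite lee_fin exprn_even_ge0.
split=> [c_fin | [M cM]].
- exists (fine (\sum_(0 <= j <oo) (Normc.normc (c j) ^+ 2)%:E)%E) => n.
  rewrite sumE lecR -lee_fin fineK; last first.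
    by rewrite ge0_fin_numE //; exact: nneseries_ge0.
  by rewrite -sumEFin; exact: nneseries_lim_ge.
- apply: (@le_lt_trans _ _ M%:E); last exact: ltry.
  apply: lime_le; first exact: is_cvg_nneseries.
  by apply: nearW => n; rewrite sumEFin lee_fin -lecR -sumE.
Qed.

(** A vector in the kernel of the Gram matrix gives a combination of norm zero,
    which the lower bound allows only for zero coefficients. *)
Lemma gram_unitmx (R : realType) (X : lmodType R[i]) (ip : {dot X for conjC})
    (x : nat -> X) (d : R) (n : nat) :
  0 < d -> lower_riesz ip x d -> gram ip x n \in unitmx.
Proof.
move=> d_gt0 dP; rewrite -row_free_unit -kermx_eq0; apply/rowV0P => v.
move=> /sub_kermxP vG; have := dP n (row_seq v).
rewrite dot_lin_comb.
have -> : \row_(i < n) row_seq v i = v by apply/rowP => i; rewrite mxE row_seqE.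
rewrite vG mul0mx mxE pmulr_rle0 ?ltcR //.
have sq_ge0 (i : 'I_n) : true -> 0 <= `|row_seq v i| ^+ 2.
  by move=> _; exact: exprn_ge0.
move=> s_le0; have /eqP : \sum_(i < n) `|row_seq v i| ^+ 2 == 0.
  by rewrite eq_le s_le0 sumr_ge0.
move/psumr_eq0P => /(_ sq_ge0) v0; apply/rowP => i; rewrite mxE.
by have /eqP := v0 i isT; rewrite expf_eq0 normr_eq0 row_seqE => /eqP.
Qed.

(** The coefficients solve a linear system whose matrix is the Gram matrix; they
    come out conjugated because [ip] is conjugate-linear on the right. *)
Lemma finite_moment_problem (R : realType) (X : lmodType R[i])
    (ip : {dot X for conjC}) (x : nat -> X) (n : nat) (c : nat -> R[i]) :
  gram ip x n \in unitmx ->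
  exists a, forall i, (i < n)%N -> ip (x i) (lin_comb x n a) = c i.
Proof.
move=> Gunit; pose b := invmx (gram ip x n) *m \col_(i < n) c i.
exists (row_seq (b ^t*)) => i i_lt_n.
have /matrixP/(_ (Ordinal i_lt_n) 0) := mulKVmx Gunit (\col_(i < n) c i).
rewrite -/b !mxE /= => <-; rewrite linear_sumr; apply: eq_bigr => j _.
by rewrite linearZr_LR /= row_seqE !mxE conjCK mulrC.
Qed.

(** For [g := lin_comb x n a] one has [ip g g = \sum_i a i * c i]. The weighted
    inequality [2 |a c| <= d |a|^2 + |c|^2 / d] bounds twice this sum by
    [d \sum_i |a i|^2 + d^-1 \sum_i |c i|^2], and the lower Riesz bound absorbs
    the first term into one copy of [ip g g]. *)
Lemma finite_moment_solution_bound (R : realType) (X : lmodType R[i])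
    (ip : {dot X for conjC}) (x : nat -> X) (d : R) (n : nat)
    (a c : nat -> R[i]) :
  0 < d -> lower_riesz ip x d ->
  (forall i, (i < n)%N -> ip (x i) (lin_comb x n a) = c i) ->
  ip (lin_comb x n a) (lin_comb x n a) <=
    d%:C^-1 * \sum_(i < n) `|c i| ^+ 2.
Proof.
move=> d_gt0 dP ac; set g := lin_comb x n a in ac *.
have dC_gt0 : 0 < d%:C by rewrite ltcR.
have gE : ip g g = \sum_(i < n) a i * c i.
  by rewrite {1}/g dot_lin_combl; apply: eq_bigr => i _; rewrite ac.
have amgm i : `|a i * c i| *+ 2 <= d%:C * `|a i| ^+ 2 + d%:C^-1 * `|c i| ^+ 2.
  rewrite -(ler_pM2l dC_gt0) -subr_ge0 normrM.
  have -> : d%:C * (d%:C * `|a i| ^+ 2 + d%:C^-1 * `|c i| ^+ 2)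
      - d%:C * (`|a i| * `|c i| *+ 2) = (d%:C * `|a i| - `|c i|) ^+ 2.
    by field; rewrite gt_eqF.
  by rewrite real_exprn_even_ge0 // rpredB ?normr_real // rpredM ?normr_real //;
     exact: gtr0_real.
have : ip g g *+ 2 <= ip g g + d%:C^-1 * \sum_(i < n) `|c i| ^+ 2.
  apply: (@le_trans _ _ (\sum_(i < n) `|a i * c i| *+ 2)).
    rewrite sumrMnl lerMn2r /= -(ger0_norm (dnorm_ge0 ip g)) gE.
    exact: ler_norm_sum.
  apply: (@le_trans _ _
      (\sum_(i < n) (d%:C * `|a i| ^+ 2 + d%:C^-1 * `|c i| ^+ 2))).
    by apply: ler_sum => i _; exact: amgm.
  by rewrite big_split /= -!mulr_sumr lerD2r; exact: dP.
by rewrite mulr2n lerD2l.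
Qed.

(** By the Pythagorean identity the squared norms are nondecreasing, hence
    convergent, and their differences are the squared distances: the sequence is
    Cauchy. *)
Lemma cvg_orthogonal_increments (R : realType) (X : completeNormedModType R[i])
    (g : nat -> X) (M : R) :
  (forall n m, (n <= m)%N -> `|g m - g n| ^+ 2 = `|g m| ^+ 2 - `|g n| ^+ 2) ->
  (forall n, `|g n| ^+ 2 <= M%:C) -> cvgn g.
Proof.
move=> incr gM; pose s n := complex.Re (`|g n| ^+ 2).
have sE n : `|g n| ^+ 2 = (s n)%:C.
  by rewrite /s RRe_real // ger0_real // exprn_ge0.
have s_nd : nondecreasing_seq s.
  by move=> n m nm; rewrite -lecR -!sE -subr_ge0 -incr // exprn_ge0.
have s_cvg : cvgn s.
  apply: nondecreasing_is_cvgn => //; exists M => _ [n _ <-].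
  by rewrite -lecR -sE.
have s_le n : s n <= limn s by exact: nondecreasing_cvgn_le.
apply: cauchy_cvg; apply: cauchy_exP => e e_gt0.
have eE : e = (complex.Re e)%:C by rewrite RRe_real // gtr0_real.
have Re_gt0 : 0 < complex.Re e by rewrite -ltcR -eE.
have /cvgrPdist_lt/(_ _ (exprn_gt0 2 Re_gt0))[N _ sN] := s_cvg.
exists (g N); exists N => // n /= Nn.
rewrite -ball_normE /= distrC -(@ltr_pXn2r _ 2) ?nnegrE ?(ltW e_gt0) //.
rewrite incr // !sE eE -rmorphB -rmorphXn ltcR.
apply: le_lt_trans (lerB (s_le n) (lexx _)) _.
exact: le_lt_trans (ler_norm _) (sN N (leqnn N)).
Qed.

(** The solution [g n] of the first [n] equations in the span of [x 0], ..,
    [x (n - 1)] is the one of minimal norm: for [m >= n], [g m - g n] is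
    orthogonal to these vectors, hence to [g n]. So the increments are
    orthogonal, and the norms are bounded uniformly in [n]. *)
Lemma lower_riesz_moment_problem (R : realType) (X : completeNormedModType R[i])
    (ip : {dot X for conjC}) (ip_norm : forall u : X, ip u u = `|u| ^+ 2)
    (x : nat -> X) (d : R) (c : nat -> R[i]) :
  0 < d -> lower_riesz ip x d -> square_summable c ->
  exists g : X, forall j : nat, c j = ip (x j) g.
Proof.
move=> d_gt0 dP /square_summableP[M cM].
have /choice[a aP] n := finite_moment_problem c (gram_unitmx n d_gt0 dP).
pose g n := lin_comb x n (a n).
have gP n i : (i < n)%N -> ip (x i) (g n) = c i by exact: aP.
(* [g n] is a combination of vectors on which [g m] and [g n] have equal moments. *)
have gg n m : (n <= m)%N -> ip (g n) (g m) = ip (g n) (g n).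
  move=> nm; rewrite {1 3}/g !dot_lin_combl; apply: eq_bigr => i _.
  by rewrite !gP // (leq_trans _ nm).
have g_cvg : cvgn g.
  apply: (@cvg_orthogonal_increments _ _ g (d^-1 * M)) => [n m nm|n].
    rewrite -!ip_norm dnormB (dot_conj ip (g m) (g n)) gg // conjCK !gg //.
    rewrite (geC0_conj (dnorm_ge0 ip (g n))).
    by rewrite opprD addrA addrK.
  rewrite -ip_norm rmorphM fmorphV.
  apply: le_trans (finite_moment_solution_bound d_gt0 dP (aP n)) _.
  by rewrite ler_pM2l ?invr_gt0 ?ltcR.
(* Pairing with [x j] is continuous, and [ip (x j) (g n)] is constant for [n > j]. *)
exists (limn g) => j; apply/eqP; rewrite -subr_eq0 -normr_eq0.
apply: contraT => ne0.
have e_gt0 : 0 < `|c j - ip (x j) (limn g)| / (`|x j| + 1).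
  by rewrite divr_gt0 ?ltr_wpDl // lt_def ne0 normr_ge0.
have /cvgrPdist_lt/(_ _ e_gt0)[N _ gN] := g_cvg.
pose n := maxn N j.+1.
have := gN n (leq_maxl _ _).
rewrite ltr_pdivlMr ?ltr_wpDl // -(gP n j) ?leq_maxr // -raddfB /= => lt_e.
have := lt_le_trans lt_e (dot_le_norm ip_norm _ _).
by rewrite distrC mulrC le_gtF // ler_wpM2r // lerDl.
Qed.

(** * Solvability of the moment problem forces a lower Riesz bound *)

(** Solve the moment problem for the unit sequences. *)
Lemma biorthogonal_of_moment_problem (R : realType) (X : lmodType R[i])
    (ip : {dot X for conjC}) (x : nat -> X) :
  (forall c : nat -> R[i], square_summable c ->
     exists g : X, forall j : nat, c j = ip (x j) g) ->
  exists y : nat -> X, forall i j, ip (x j) (y i) = (j == i)%:R.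
Proof.
move=> solvable.
suff /choice[y yP] i : exists g, forall j, ip (x j) g = (j == i)%:R by exists y.
have [|g gP] := solvable (fun j => (j == i)%:R); last by exists g.
apply/square_summableP; exists 1 => n.
have [i_lt_n | n_le_i] := ltnP i n.
- rewrite (bigD1 (Ordinal i_lt_n)) //= eqxx normr1 expr1n big1 ?addr0 // => j.
  by rewrite -val_eqE /= => /negPf->; rewrite normr0 expr0n.
- rewrite big1 ?ler01 // => j _.
  by rewrite ltn_eqF ?(leq_trans _ n_le_i) // normr0 expr0n.
Qed.

(** Coordinates are read off by pairing with the biorthogonal family, so they are
    small as soon as the combination is small; this is what keeps the successive
    humps below from interfering. *)
Lemma coordinate_le (R : realType) (X : normedModType R[i])
    (ip : {dot X for conjC}) (ip_norm : forall u : X, ip u u = `|u| ^+ 2)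
    (x y : nat -> X) (n : nat) (v : nat -> R[i]) (i : nat) :
  (forall i j, ip (x j) (y i) = (j == i)%:R) -> (i < n)%N ->
  `|v i| <= `|lin_comb x n v| * `|y i|.
Proof.
move=> xy i_lt_n; suff -> : v i = ip (lin_comb x n v) (y i) by exact: dot_le_norm.
rewrite dot_lin_combl (bigD1 (Ordinal i_lt_n)) //= xy eqxx mulr1 big1 ?addr0 //.
by move=> j; rewrite -val_eqE /= xy => /negPf->; rewrite mulr0.
Qed.

Lemma sum_zero_pad (V : zmodType) (F : nat -> V) (n m : nat) : (n <= m)%N ->
  (forall i, (n <= i)%N -> F i = 0) -> \sum_(i < m) F i = \sum_(i < n) F i.
Proof.
move=> nm F0; rewrite -!(big_mkord xpredT) (big_cat_nat (n := n)) //=.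
rewrite [X in _ + X]big_nat_cond [X in _ + X]big1 ?addr0 //.
by move=> i /andP[/andP[ni _] _]; exact: F0.
Qed.

(** Normalize coefficients that violate the lower bound. Padding them with zeros
    makes the length as large as wanted. *)
Lemma not_lower_riesz_unit_vector (R : realType) (X : normedModType R[i])
    (ip : {dot X for conjC}) (ip_norm : forall u : X, ip u u = `|u| ^+ 2)
    (x : nat -> X) (e : R) (N : nat) :
  0 < e -> ~ lower_riesz ip x (e ^+ 2) ->
  exists m (v : nat -> R[i]), [/\ (N <= m)%N, \sum_(i < m) `|v i| ^+ 2 = 1
    & `|lin_comb x m v| <= e%:C].
Proof.
move=> e_gt0 /existsNP[n /existsNP[w /negP]].
set s := \sum_(i < n) `|w i| ^+ 2; rewrite ip_norm.
have s_ge0 : 0 <= s by apply: sumr_ge0 => i _; exact: exprn_ge0.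
have eC_gt0 : 0 < e%:C by rewrite ltcR.
rewrite rmorphXn /= -real_ltNge ?ger0_real ?mulr_ge0 ?exprn_ge0 ?(ltW eC_gt0) //.
move=> S_lt; have s_gt0 : 0 < s.
  rewrite lt_def s_ge0 andbT; apply: contraTneq S_lt => ->.
  by rewrite mulr0 le_gtF // exprn_ge0.
pose r := (sqrtC s)^-1.
have r_gt0 : 0 < r by rewrite invr_gt0 sqrtC_gt0.
have rs : r ^+ 2 * s = 1 by rewrite /r exprVn sqrtCK mulVf // gt_eqF.
pose v i := if (i < n)%N then r * w i else 0.
have v0 i : (n <= i)%N -> v i = 0 by rewrite leqNgt /v => /negPf->.
exists (maxn N n), v; split; first exact: leq_maxl.
- rewrite (sum_zero_pad (F := fun i => `|v i| ^+ 2) (leq_maxr N n)); last first.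
    by move=> i /v0 ->; rewrite normr0 expr0n.
  rewrite -rs /s mulr_sumr; apply: eq_bigr => i _.
  by rewrite /v ltn_ord normrM exprMn (gtr0_norm r_gt0).
- have -> : lin_comb x (maxn N n) v = r *: lin_comb x n w.
    rewrite /lin_comb (sum_zero_pad (F := fun i => v i *: x i) (leq_maxr N n)).
      by rewrite scaler_sumr; apply: eq_bigr => i _; rewrite /v ltn_ord scalerA.
    by move=> i /v0 ->; rewrite scale0r.
  rewrite -(@ler_pXn2r _ 2) ?nnegrE ?(ltW eC_gt0) // normrZ exprMn.
  have -> : e%:C ^+ 2 = r ^+ 2 * (e%:C ^+ 2 * s) by rewrite mulrCA rs mulr1.
  rewrite (gtr0_norm r_gt0) ler_pM2l ?exprn_gt0 //.
  exact: ltW.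
Qed.

(** The bound on coordinates pushes a unit vector with a small combination
    almost entirely beyond any given index [N]: at least half of its squared mass
    lies there. The assumption [h <= 2^-1] makes the moduli before [N] at most 1,
    so that the squared mass there is at most their sum, hence at most [2^-1]. *)
Lemma hump (R : realType) (X : normedModType R[i])
    (ip : {dot X for conjC}) (ip_norm : forall u : X, ip u u = `|u| ^+ 2)
    (x y : nat -> X) (N : nat) (h : R) :
  (forall i j, ip (x j) (y i) = (j == i)%:R) ->
  (forall d : R, 0 < d -> ~ lower_riesz ip x d) ->
  0 < h -> h <= 2^-1 ->
  exists mv : nat * (nat -> R[i]), let: (m, v) := mv in
  [/\ (N < m)%N, \sum_(0 <= i < N) `|v i| <= h%:C, `|lin_comb x m v| <= h%:C,
      \sum_(N <= i < m) `|v i| ^+ 2 <= 1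
    & 2^-1 <= \sum_(N <= i < m) `|v i| ^+ 2].
Proof.
move=> xy not_riesz h_gt0 h_le.
pose Y := \sum_(0 <= i < N) `|y i|.
have Y_ge0 : 0 <= Y by exact: sumr_ge0.
have YE : Y = (complex.Re Y)%:C by rewrite RRe_real // ger0_real.
have ReY_ge0 : 0 <= complex.Re Y by rewrite -lecR -YE.
(* Coordinates before [N] are at most [e * `|y i|] in modulus, so they sum to at
   most [h]; the summand 1 gives [e <= h] and a nonzero denominator. *)
pose e := h / (1 + complex.Re Y).
have ReY1_gt0 : 0 < 1 + complex.Re Y by rewrite ltr_wpDr.
have e_gt0 : 0 < e by rewrite divr_gt0.
have e_le : e <= h by rewrite ler_pdivrMr // mulrDr mulr1 lerDl mulr_ge0 // ltW.
have [m [v [Nm v1 S_le]]] :=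
  not_lower_riesz_unit_vector ip_norm N.+1 e_gt0 (not_riesz _ (exprn_gt0 2 e_gt0)).
have head : \sum_(0 <= i < N) `|v i| <= h%:C.
  apply: (@le_trans _ _ (e%:C * Y)).
    rewrite mulr_sumr big_nat [leRHS]big_nat; apply: ler_sum => i /andP[_ iN].
    apply: le_trans (coordinate_le ip_norm v xy (ltn_trans iN Nm)) _.
    exact: ler_wpM2r.
  rewrite YE -rmorphM lecR mulrAC ler_pdivrMr // ler_wpM2l ?(ltW h_gt0) //.
  by rewrite lerDr.
have v_le1 i : (i < N)%N -> `|v i| <= 1.
  move=> iN; apply: le_trans (_ : h%:C <= 1); last first.
    by rewrite -[1]/(1%:C) lecR (le_trans h_le) // invf_le1 // ler1n.
  apply: le_trans head; rewrite big_mkord (bigD1 (Ordinal iN)) //= lerDl.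
  exact: sumr_ge0.
have head2 : \sum_(0 <= i < N) `|v i| ^+ 2 <= 2^-1.
  apply: (@le_trans _ _ h%:C); last first.
    suff -> : 2^-1 = (2^-1)%:C :> R[i] by rewrite lecR.
    by rewrite fmorphV rmorph_nat.
  apply: le_trans head; rewrite big_nat [leRHS]big_nat.
  apply: ler_sum => i /andP[_ iN].
  by rewrite expr2 ler_piMr // v_le1.
have total : \sum_(0 <= i < N) `|v i| ^+ 2 + \sum_(N <= i < m) `|v i| ^+ 2 = 1.
  by rewrite -big_cat_nat //= ?big_mkord // ltnW.
exists (m, v); split=> //.
- by apply: le_trans S_le _; rewrite lecR.
- rewrite -total lerDr; apply: sumr_ge0 => i _; exact: exprn_ge0.
- have half : 1 - 2^-1 = 2^-1 :> R[i] by field.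
  rewrite -half lerBlDr -[leLHS]total addrC lerD2l.
  exact: head2.
Qed.

(** The blocks are disjoint, so at most one term of the sum defining [c i] is
    present; since [k <= n k], no block that contains [i] has a number beyond
    [i], and a finite sum is enough. *)
Lemma glue_blocks (V : zmodType) (n : nat -> nat) (f : nat -> nat -> V) :
  (forall k, (n k < n k.+1)%N) ->
  exists c, forall k i, (n k <= i < n k.+1)%N -> c i = f k i.
Proof.
move=> n_incr.
have n_homo : {homo n : j k / (j <= k)%N}.
  by apply: homo_leq => // [? ? ? |k]; [exact: leq_trans | exact: ltnW].
have n_ge k : (k <= n k)%N by elim: k => // k IH; exact: leq_ltn_trans (n_incr k).
exists (fun i => \sum_(k < i.+1 | (n k <= i < n k.+1)%N) f k i) => k i ki.
have [nk_le i_lt] := andP ki.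
have k_lt : (k < i.+1)%N by rewrite ltnS (leq_trans (n_ge k)).
rewrite (big_pred1 (Ordinal k_lt)) // => j; rewrite /= -val_eqE /=.
apply/idP/eqP => [/andP[nj_le i_ltj] | -> //]; apply/eqP; rewrite eqn_leq.
apply/andP; split; rewrite leqNgt; apply/negP => jk.
- by have := leq_trans i_lt (n_homo _ _ jk); rewrite ltnNge nj_le.
- by have := leq_trans i_ltj (n_homo _ _ jk); rewrite ltnNge nk_le.
Qed.

(** Gliding hump. If no lower bound holds, choose successive blocks
    [n k <= i < n k.+1] and vectors [v k] with half of their mass in the block and
    [|lin_comb x (n k.+1) (v k)| <= 4^-k / 2]. Put [c i := 2^-k * (v k i)^*] on the
    [k]-th block; [c] is square summable. If [g] solves the moment problem for [c],
    then [\sum_i v k i * c i = ip (lin_comb x (n k.+1) (v k)) g] has modulus at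
    most [4^-k |g| / 2], while its part in the block is at least [2^-k / 2]. Hence
    [2^k <= |g| + 2] for every [k]. *)
Lemma moment_problem_lower_riesz (R : realType) (X : normedModType R[i])
    (ip : {dot X for conjC}) (ip_norm : forall u : X, ip u u = `|u| ^+ 2)
    (x : nat -> X) :
  (forall c : nat -> R[i], square_summable c ->
     exists g : X, forall j : nat, c j = ip (x j) g) ->
  exists2 d : R, 0 < d & lower_riesz ip x d.
Proof.
move=> solvable; have [y xy] := biorthogonal_of_moment_problem solvable.
apply: contrapT => no_bound.
have not_riesz d : 0 < d -> ~ lower_riesz ip x d.
  by move=> d_gt0 dP; apply: no_bound; exists d.
(* The error [h k = 4^-k / 2] has to be negligible, for large [k], against the
   contribution [2^-k / 2] of the [k]-th hump. *)
pose h k : R := 2^-1 ^+ k ^+ 2 * 2^-1.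
have h_gt0 k : 0 < h k by rewrite mulr_gt0 ?exprn_gt0 ?invr_gt0.
have h_le k : h k <= 2^-1.
  rewrite ler_piMl ?invr_ge0 // !exprn_ile1 ?exprn_ge0 ?invr_ge0 //.
  by rewrite invf_le1 // ler1n.
have /choice[F FP] (Nk : nat * nat) :=
  hump ip_norm Nk.1 xy not_riesz (h_gt0 Nk.2) (h_le Nk.2).
(* The [k]-th hump is chosen beyond the end [n k] of the previous one. *)
pose n := fix n k := if k is j.+1 then (F (n j, j)).1 else 0%N.
pose v k := (F (n k, k)).2.
have nS k : n k.+1 = (F (n k, k)).1 by [].
have {}FP k : [/\ (n k < n k.+1)%N, \sum_(0 <= i < n k) `|v k i| <= (h k)%:C,
    `|lin_comb x (n k.+1) (v k)| <= (h k)%:C,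
    \sum_(n k <= i < n k.+1) `|v k i| ^+ 2 <= 1
  & 2^-1 <= \sum_(n k <= i < n k.+1) `|v k i| ^+ 2].
  by have := FP (n k, k); rewrite nS /v; case: (F _) => m w /=.
have n_incr k : (n k < n k.+1)%N by case: (FP k).
pose t : R[i] := 2^-1.
have t_gt0 : 0 < t by rewrite invr_gt0.
have t_le1 : t <= 1 by rewrite invf_le1 // ler1n.
have hE k : (h k)%:C = t ^+ k ^+ 2 * t.
  by rewrite /h rmorphM !rmorphXn fmorphV rmorph_nat.
have [c cP] := glue_blocks (fun k i => t ^+ k * conjC (v k i)) n_incr.
(* The [k]-th block contributes at most [4^-k <= 2^-k], and the term [t ^+ k *+ 2]
   decreases by exactly [2^-k] when [k] is incremented. *)
have c_sum k : \sum_(0 <= i < n k) `|c i| ^+ 2 + t ^+ k *+ 2 <= 2.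
  elim: k => [|k IH]; first by rewrite big_geq // add0r expr0.
  apply: le_trans IH; rewrite (big_cat_nat (n := n k)) ?(ltnW (n_incr k)) //=.
  have -> : t ^+ k.+1 *+ 2 = t ^+ k by rewrite exprSr /t; field.
  rewrite -addrA lerD2l mulr2n lerD2r.
  have -> : \sum_(n k <= i < n k.+1) `|c i| ^+ 2 =
      t ^+ k ^+ 2 * \sum_(n k <= i < n k.+1) `|v k i| ^+ 2.
    rewrite mulr_sumr; apply: eq_big_nat => i /cP ->.
    by rewrite normrM exprMn norm_conjC (gtr0_norm (exprn_gt0 k t_gt0)).
  have [_ _ _ v_le _] := FP k.
  apply: le_trans (ler_wpM2l _ v_le) _; first by rewrite !exprn_ge0 // ltW.
  by rewrite mulr1 expr2 ler_piMl ?exprn_ile1 ?exprn_ge0 // ltW.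
have {}c_sum k : \sum_(0 <= i < n k) `|c i| ^+ 2 <= 2.
  by apply: le_trans (c_sum k); rewrite lerDl mulrn_wge0 // exprn_ge0 // ltW.
have n_ge k : (k <= n k)%N by elim: k => // k IH; exact: leq_ltn_trans (n_incr k).
have c_summable : square_summable c.
  apply/square_summableP; exists 2 => k; rewrite rmorph_nat.
  apply: le_trans (c_sum k); rewrite -(big_mkord xpredT (fun i => `|c i| ^+ 2)).
  rewrite [leRHS](big_cat_nat (n := k)) //= lerDl.
  by apply: sumr_ge0 => i _; exact: exprn_ge0.
have c_le i : `|c i| <= 2.
  rewrite -(@ler_pXn2r _ 2) ?nnegrE //; apply: (@le_trans _ _ 2).
    apply: le_trans (c_sum i.+1).
    rewrite big_mkord (bigD1 (Ordinal (n_ge i.+1))) //= lerDl.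
    by apply: sumr_ge0 => j _; exact: exprn_ge0.
  by rewrite expr2 ler_peMr // ler1n.
have [g gP] := solvable c c_summable.
have g_large k : 2 ^+ k <= `|g| + 2.
  have [_ head S_le _ v_ge] := FP k.
  have tk_gt0 : 0 < t ^+ k by exact: exprn_gt0.
  have SE : ip (lin_comb x (n k.+1) (v k)) g =
      \sum_(0 <= i < n k) v k i * c i
      + t ^+ k * \sum_(n k <= i < n k.+1) `|v k i| ^+ 2.
    rewrite dot_lin_combl -(big_mkord xpredT (fun i => v k i * ip (x i) g)).
    rewrite (big_cat_nat (n := n k)) ?(ltnW (n_incr k)) //=; congr (_ + _).
      by apply: eq_bigr => i _; rewrite -gP.
    rewrite mulr_sumr; apply: eq_big_nat => i ki.
    by rewrite -gP (cP k) // mulrCA -normCK.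
  have head_le : `|\sum_(0 <= i < n k) v k i * c i| <= (h k)%:C * 2.
    apply: le_trans (ler_norm_sum _ _ _) _.
    apply: le_trans (ler_wpM2r (ler0n _ 2) head); rewrite mulr_suml.
    by apply: ler_sum => i _; rewrite normrM ler_wpM2l.
  have block_le : t ^+ k * t <= (h k)%:C * (`|g| + 2).
    apply: (@le_trans _ _ (t ^+ k * \sum_(n k <= i < n k.+1) `|v k i| ^+ 2)).
      by rewrite ler_pM2l.
    have -> : t ^+ k * \sum_(n k <= i < n k.+1) `|v k i| ^+ 2 =
        `|ip (lin_comb x (n k.+1) (v k)) g - \sum_(0 <= i < n k) v k i * c i|.
      rewrite SE addrAC subrr add0r ger0_norm // mulr_ge0 ?(ltW tk_gt0) //.
      by apply: sumr_ge0 => i _; exact: exprn_ge0.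
    apply: le_trans (ler_normB _ _) _; rewrite mulrDr; apply: lerD => //.
    by apply: le_trans (dot_le_norm ip_norm _ _) _; exact: ler_wpM2r.
  have : 1 <= t ^+ k * (`|g| + 2).
    rewrite -(@ler_pM2l _ (t ^+ k * t)) ?mulr_gt0 // mulr1.
    by apply: le_trans block_le _; rewrite hE expr2 -!mulrA (mulrCA _ t).
  by rewrite /t exprVn mulrC ler_pdivlMr ?exprn_gt0 // mul1r.
have g2E : `|g| + 2 = (complex.Re (`|g| + 2))%:C.
  by rewrite RRe_real // ger0_real // addr_ge0.
have r_ge0 : 0 <= complex.Re (`|g| + 2) by rewrite -lecR -g2E addr_ge0.
have := archi_boundP r_ge0.
set k := Num.bound _.
have := g_large k; rewrite g2E -(rmorph_nat (real_complex R)) -rmorphXn lecR => le_r.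
move/(le_lt_trans le_r); rewrite -natrX ltr_nat ltnNge.
by rewrite ltnW // ltn_expl.
Qed.

(** * The moment problem and strong minimality *)

Theorem theorem2 (R : realType) (X : completeNormedModType R[i])
    (ip : {dot X for conjC}) (ip_norm : forall u : X, ip u u = `|u| ^+ 2)
    (X_separable : separable_space X) (x : nat -> X) :
  (forall c : nat -> R[i], square_summable c ->
     exists g : X, forall j : nat, c j = ip (x j) g)
  <-> strongly_minimal ip x.
Proof.
rewrite strongly_minimalP; split; first exact: moment_problem_lower_riesz.
move=> [d d_gt0 dP] c.
exact (lower_riesz_moment_problem ip_norm d_gt0 dP (c := c)).
Qed.
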